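(* Let $G=(\mathcal{V},\Omega,\mathcal{E})$ be a tomographically complete generalized probabilistic theory for which there exists $d\in\mathbb{N}$ such that $G$ is simplex-embeddable in $d$ dimensions. Then $G$ is also simplex-embeddable in $d_{\min}\in\mathbb{N}$ dimensions for some $d_{\min}$ with $$\dim(\mathcal{V})\le d_{\min}\le\dim(\mathcal{V})^2.$$ That is, $b(G)=\dim(\mathcal{V})^2$ is a number such that if $G$ is simplex-embeddable, then it is simplex-embeddable in at most $b(G)$ dimensions.
   Context: Generalized probabilistic theory. $\mathcal{V}$ is a finite-dimensional real inner product space; $\Omega,\mathcal{E}\subseteq\mathcal{V}$ are nonempty bounded convex sets with $\langle s,e\rangle_{\mathcal{V}}\ge0$ for all $s\in\Omega$, $e\in\mathcal{E}$; $0\in\mathcal{E}$; there is $u\in\mathcal{E}$ with $\langle s,u\rangle_{\mathcal{V}}=1$ for all $s\in\Omega$; and for every $e\in\mathcal{E}$ there is a (finite or countable) family $\{e_k\in\mathcal{E}\}_k$ with $e+\sum_ke_k=u$. It is tomographically complete if $\mathrm{span}(\Omega)=\mathrm{span}(\mathcal{E})=\mathcal{V}$. Simplex-embeddability. A tomographically complete $(\mathcal{V},\Omega,\mathcal{E})$ is simplex-embeddable in $d$ dimensions if there exist: a $d$-dimensional real inner product space $\mathcal{W}$; a simplex $\Delta_d\subset\mathcal{W}$ which is the convex hull of $d$ linearly independent vertices $\{\delta_i\in\mathcal{W}\}_{i=1}^d$; a linear map $\iota:\mathcal{V}\to\mathcal{W}$ with $\iota(\Omega)\subseteq\Delta_d$;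 and a linear map $\kappa:\mathcal{V}\to\mathcal{W}$ with $\langle\kappa(E),\delta_i\rangle_{\mathcal{W}}\in[0,1]$ for all $E\in\mathcal{E}$ and $i=1,\dots,d$; such that $\langle\rho,E\rangle_{\mathcal{V}}=\langle\iota(\rho),\kappa(E)\rangle_{\mathcal{W}}$ for all $\rho\in\Omega$, $E\in\mathcal{E}$. It is simplex-embeddable if it is so in $d$ dimensions for some $d\in\mathbb{N}$. *)

(* Defs.v *)
From HB Require Import structures.
From mathcomp Require Import all_boot all_order all_algebra.
From mathcomp Require Import sesquilinear.
From mathcomp Require Import all_classical all_reals all_analysis.

Set Implicit Arguments.
Unset Strict Implicit.
Unset Printing Implicit Defensive.

Import Order.TTheory GRing.Theory Num.Theory.
Import numFieldNormedType.Exports.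

Local Open Scope classical_set_scope.
Local Open Scope ring_scope.

(* A finite-dimensional real inner product space is a [V : vectType R] with a
   positive definite symmetric form [{dot V for idfun}] over [R : realType].
   A bare [vectType] carries no topology, so boundedness and convergence are
   those of the norm induced by the form. *)

Section InnerProductSpace.
Context {R : realType} {V : vectType R} (ip : {dot V for idfun}).

Definition ip_norm (v : V) : R := Num.sqrt (ip v v).

Definition ip_bounded (A : set V) : Prop :=
  exists M : R, forall v, A v -> ip_norm v <= M.

Definition ip_cvg (x : nat -> V) (l : V) : Prop :=
  (fun n : nat => ip_norm (x n - l)) @ \oo --> (0 : R).

End InnerProductSpace.

Definition lin_span (R : realType) (V : vectType R) (A : set V) : set V :=
  [set v | exists (n : nat) (x : 'I_n -> V) (c : 'I_n -> R),
      (forall i, A (x i)) /\ v = \sum_(i < n) c i *: x i].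

Definition conv_hull (R : realType) (W : vectType R) (d : nat)
    (delta : d.-tuple W) : set W :=
  [set w | exists c : 'I_d -> R,
      [/\ forall i, 0 <= c i, \sum_(i < d) c i = 1
        & w = \sum_(i < d) c i *: tnth delta i]].

Record gpt (R : realType) := Gpt {
  gpt_space : vectType R ;
  gpt_ip : {dot gpt_space for idfun} ;
  states : set gpt_space ;
  effects : set gpt_space ;
  states_neq0 : states !=set0 ;
  effects_neq0 : effects !=set0 ;
  states_bounded : ip_bounded gpt_ip states ;
  effects_bounded : ip_bounded gpt_ip effects ;
  states_convex : convex_set states ;
  effects_convex : convex_set effects ;
  gpt_ip_ge0 : forall s e, states s -> effects e -> 0 <= gpt_ip s e ;
  zero_effect : effects 0 ;
  gpt_unit : gpt_space ;
  unit_effect : effects gpt_unit ;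
  unit_normalized : forall s, states s -> gpt_ip s gpt_unit = 1 ;
  (* the complementing family is either finite or countably infinite *)
  effect_complement : forall e, effects e ->
    (exists2 f : seq gpt_space, (forall x, x \in f -> effects x)
       & e + \sum_(x <- f) x = gpt_unit)
    \/
    (exists2 f : nat -> gpt_space, (forall k, effects (f k))
       & ip_cvg gpt_ip (fun n => e + \sum_(0 <= k < n) f k) gpt_unit) }.

Arguments states {R} g _.
Arguments effects {R} g _.

Definition tomographically_complete (R : realType) (G : gpt R) : Prop :=
  lin_span (states G) = setT /\ lin_span (effects G) = setT.

Definition simplex_embeddable_in (R : realType) (G : gpt R) (d : nat) : Prop :=
  exists (W : vectType R) (ipW : {dot W for idfun}) (delta : d.-tuple W)
         (iota kappa : {linear gpt_space G -> W}),
    [/\ \dim {: W} = d,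
        free delta,
        forall s, states G s -> conv_hull delta (iota s),
        forall e, effects G e ->
          forall i : 'I_d, 0 <= ipW (kappa e) (tnth delta i) <= 1
      & forall s e, states G s -> effects G e ->
          gpt_ip G s e = ipW (iota s) (kappa e)].

(* Main.v *)
Require Import Defs.
From HB Require Import structures.
From mathcomp Require Import all_boot all_order all_algebra.
From mathcomp Require Import sesquilinear.
From mathcomp Require Import all_classical all_reals all_analysis.
From mathcomp Require Import ring lra.

Set Implicit Arguments.
Unset Strict Implicit.
Unset Printing Implicit Defensive.

Import Order.TTheory GRing.Theory Num.Theory.
Import numFieldNormedType.Exports.

Local Open Scope classical_set_scope.
Local Open Scope ring_scope.

(** A simplex embedding in [d] dimensions amounts to a decomposition
    [<s, e> = \sum_(i < d) a_i(s) b_i(e)] on the whole of [V], where the [a_i]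
    are nonnegative on states and sum to 1 there, and the [b_i] take values in
    [0, 1] on effects. It exhibits the inner product as a conic combination of
    the rank-one forms [a_i b_i], so by Caratheodory's theorem [n ^ 2] of them,
    [n = dim V], suffice, with weights [c_i >= 0]. Replacing [a_i] by
    [c_i b_i(u) a_i] and [b_i] by [b_i / b_i(u)] restores both normalizations:
    [\sum_i c_i b_i(u) a_i(s) = <s, u> = 1], and [b_i(e) <= b_i(u)] since [u] is
    the sum of [e] and other effects. The inner product has rank [n], so at least
    [n] terms are needed. *)

(** * Linear forms and finite-dimensional inner products *)

Definition scalar_of (R : realType) (V : lmodType R) (f : V -> R)
    (hf : scalar f) : {scalar V} :=
  HB.pack f (GRing.isLinear.Build R V R *%R f hf).

Lemma scalar_eq0_on_span (R : realType) (V : vectType R) (A : set V)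
    (f : V -> R) :
  scalar f -> lin_span A = setT -> (forall x, A x -> f x = 0) ->
  forall x, f x = 0.
Proof.
move=> hf spanA f0 x.
have : lin_span A x by rewrite spanA.
case=> n [y [c [Ay ->]]].
rewrite -[f]/(scalar_of hf : V -> R) linear_sum big1 // => i _.
by rewrite linearZ /= f0 // mulr0.
Qed.

Section DotForms.
Context {R : realType} {V : vectType R} (ip : {dot V for idfun}).

Lemma dotC u v : ip u v = ip v u.
Proof. by rewrite hermC expr0 mul1r. Qed.

Lemma dot_scalarr u : scalar (ip u).
Proof. by move=> a x y; rewrite linearPr. Qed.

Lemma dot_scalarl v : scalar (ip ^~ v).
Proof. by move=> a x y /=; rewrite !(dotC _ v) dot_scalarr. Qed.

Lemma dot_eq0 v : ip v v = 0 -> v = 0.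
Proof. by have [//|/neq0_dnorm_gt0 h /eqP] := eqVneq v 0; rewrite gt_eqF. Qed.

Lemma dot_ge0 v : 0 <= ip v v.
Proof.
have [->|/neq0_dnorm_gt0 /ltW] := eqVneq v 0; last exact.
by rewrite linear0r.
Qed.

Lemma dot_cauchy_schwarz u v : `|ip u v| <= ip_norm ip u * ip_norm ip v.
Proof.
rewrite /ip_norm -sqrtrM ?dot_ge0// -sqrtr_sqr ler_sqrt ?mulr_ge0 ?dot_ge0//.
have [->|vn0] := eqVneq v 0.
  by rewrite linear0r expr0n mulr_ge0 ?dot_ge0.
have v0 : 0 < ip v v by apply: neq0_dnorm_gt0.
(* With the names set below, the squared norm of this vector is [a * (a * c - b * b)], and [a > 0]
   can be cancelled. *)
have := dot_ge0 (ip v v *: u - ip u v *: v).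
rewrite linearBr !linearBl !linearZl_LR !linearZr_LR /= (dotC v u).
rewrite -![_ *: _]/(_ * _).
set a := ip v v in v0 *; set b := ip u v; set c := ip u u => h.
have : 0 <= a * (a * c - b * b) by nra.
by rewrite pmulr_rge0 // subr_ge0 expr2 [c * a]mulrC.
Qed.

(** The Gram matrix [M] of a basis is invertible, so the coordinates of [w] solve a linear system.
    Combined with Cauchy-Schwarz, this makes every linear form continuous for [ip_norm]. *)
Lemma dot_riesz (f : {scalar V}) : exists w, forall v, f v = ip w v.
Proof.
pose n : nat := \dim {: V}; pose B := vbasis {: V}.
pose M : 'M[R]_n := \matrix_(p, q) ip B`_p B`_q.
have dotB (c : 'I_n -> R) v :
    ip (\sum_p c p *: B`_p) v = \sum_p c p * ip B`_p v.
  rewrite linear_sumlz; apply: eq_bigr => p _.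
  by rewrite linearZl_LR.
have Mfree : row_free M.
  (* A row in the kernel of [M] gives a vector [w] orthogonal to the whole basis, hence to
     itself. *)
  rewrite -kermx_eq0; apply/rowV0P => c /sub_kermxP cM.
  pose w := \sum_p c 0 p *: B`_p.
  have w0 : w = 0.
    apply: dot_eq0; rewrite {1}/w dotB.
    rewrite big1 // => p _.
    have -> : ip B`_p w = 0; last by rewrite mulr0.
    rewrite dotC dotB; have /rowP/(_ p) := cM; rewrite !mxE => cMp.
    rewrite -[RHS]cMp.
    by apply: eq_bigr => q _; rewrite mxE.
  apply/rowP => p; rewrite mxE.
  have /freeP/(_ (c 0) w0) // := basis_free (vbasisP {: V}).
pose c := (\row_q f B`_q) *m invmx M.
exists (\sum_p c 0 p *: B`_p) => v.
rewrite (coord_vbasis (memvf v)) linear_sum linear_sumr.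
apply: eq_bigr => q _; rewrite linearZ linearZr_LR /= dotB; congr (_ * _).
have : (c *m M) 0 q = f B`_q by rewrite mulmxKV -?row_free_unit // mxE.
rewrite mxE => cMq; rewrite -[LHS]cMq.
by apply: eq_bigr => p _; rewrite [M _ _]mxE.
Qed.

End DotForms.

(** * Convex geometry: sparse conic combinations *)

(** Induction on a bound for the support size: as long as the support exceeds the dimension, its
    vectors are dependent, and subtracting a suitable multiple of a dependency removes an index. *)
Lemma conic_caratheodory (R : realFieldType) (U : vectType R) (d : nat)
    (x : 'I_d -> U) (c : 'I_d -> R) :
  (forall i, 0 <= c i) ->
  exists c' : 'I_d -> R,
    [/\ forall i, 0 <= c' i, \sum_i c' i *: x i = \sum_i c i *: x i
      & (#|[pred i | c' i != 0%R]| <= \dim {: U})%N].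
Proof.
move: {2}#|_| (leqnn #|[pred i | c i != 0]|) => m.
elim: m c => [|m IH] c cm c0.
  by exists c; split => //; apply: leq_trans cm _.
have [small|big] := leqP #|[pred i | c i != 0]| (\dim {: U}).
  by exists c.
pose S := [pred i | c i != 0].
pose X := [tuple x (enum_val j) | j < #|S|].
have XE (j : 'I_#|S|) : X`_j = x (enum_val j) by rewrite -tnth_nth tnth_mktuple.
have [k [kx [j0 kj0]]] : exists k : 'I_#|S| -> R,
    \sum_j k j *: x (enum_val j) = 0 /\ exists j, 0 < k j.
  have /negP nfree : ~~ free X.
    apply: contraL big => /eqP; rewrite size_tuple -leqNgt => <-.
    exact/dimvS/subvf.
  have [k] : exists k : 'I_#|S| -> R,
      ~ (\sum_j k j *: X`_j = 0 -> forall j, k j = 0).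
    by apply/existsNP => h; apply: nfree; apply/freeP.
  move=> /not_implyP[kx /existsNP[j /eqP]]; rewrite neq_lt => kj.
  have {}kx : \sum_j k j *: x (enum_val j) = 0.
    by rewrite -[RHS]kx; apply: eq_bigr => i _; rewrite XE.
  (* Changing the sign if necessary gives a positive coefficient, so that subtracting multiples of
     the dependency can bring a weight down to zero. *)
  case/orP: kj => kj; last by exists k; split => //; exists j.
  exists (fun i => - k i); split; last by exists j; rewrite oppr_gt0.
  by under eq_bigr do rewrite scaleNr; rewrite sumrN kx oppr0.
(* [mu] extends the dependency [k] by zero from the support to all indices. *)
pose mu i := \sum_(j | enum_val j == i) k j.
have mu_val j : mu (enum_val j) = k j.
  by rewrite /mu (big_pred1 j) // => i; rewrite (inj_eq enum_val_inj).
have muS i : i \notin S -> mu i = 0.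
  move=> iS; rewrite /mu big_pred0 // => j.
  by apply: contraNF iS => /eqP <-; apply: enum_valP.
have mux : \sum_i mu i *: x i = 0.
  rewrite -[RHS]kx [RHS](partition_big enum_val xpredT) //=.
  by apply: eq_bigr => i _; rewrite scaler_suml; apply: eq_bigr => j /eqP ->.
have mui0 : 0 < mu (enum_val j0) by rewrite mu_val.
(* The minimal ratio [t] belongs to the weight that vanishes first: [c - t * mu] is zero at [j] and
   still nonnegative elsewhere. *)
have [j muj jmin] : exists2 j, 0 < mu j &
    forall i, 0 < mu i -> c j / mu j <= c i / mu i.
  have := Order.TotalTheory.arg_minP (P := fun i => 0 < mu i)
    (fun i => c i / mu i) mui0.
  by case=> j; exists j.
pose t := c j / mu j.
have t0 : 0 <= t by rewrite divr_ge0 // ltW.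
pose c1 i := c i - t * mu i.
have c1x : \sum_i c1 i *: x i = \sum_i c i *: x i.
  under eq_bigr do rewrite scalerBl -scalerA.
  by rewrite sumrB -scaler_sumr mux scaler0 subr0.
have c1j : c1 j = 0 by rewrite /c1 divfK ?subrr // gt_eqF.
have jS : j \in S by apply: contraTT muj => /muS ->; rewrite ltxx.
rewrite -c1x; apply: IH => [|i].
  rewrite -ltnS (leq_trans _ cm) //; apply: proper_card.
  apply/properP; split.
    apply/fintype.subsetP => i; rewrite !inE /c1; apply: contra => /eqP ci.
    by rewrite ci muS ?mulr0 ?subr0 // inE ci eqxx.
  by exists j => //; rewrite inE c1j eqxx.
rewrite subr_ge0; have [mui|mui] := ltP 0 (mu i).
  by rewrite -ler_pdivlMr //; apply: jmin.
by rewrite (le_trans _ (c0 i)) // mulr_ge0_le0.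
Qed.

(** * The Euclidean space that carries the new simplex *)

Definition rV_dot (R : realType) (d : nat) (u v : 'rV[R]_d) : R :=
  \sum_i u 0 i * v 0 i.

Section RowDot.
Context {R : realType} {d : nat}.

Fact rV_dot_bilinear :
  bilinear_for *%R (idfun \; *%R) (@rV_dot R d).
Proof.
split=> [v|v] a x y; rewrite /rV_dot /= mulr_sumr -big_split;
  by apply: eq_bigr => i _; rewrite !mxE /=; ring.
Qed.

HB.instance Definition _ := bilinear_isBilinear.Build R _ _ R *%R
  (idfun \; *%R) (@rV_dot R d) rV_dot_bilinear.

Fact rV_dot_sym (u v : 'rV[R]_d) :
  rV_dot u v = (-1) ^+ false * idfun (rV_dot v u).
Proof. by rewrite mul1r; apply: eq_bigr => i _; rewrite mulrC. Qed.

HB.instance Definition _ := isHermitianSesquilinear.Build R _ false idfun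
  (@rV_dot R d) rV_dot_sym.

Fact rV_dot_gt0 (u : 'rV[R]_d) : u != 0 -> 0 < rV_dot u u.
Proof.
case/rV0Pn=> i ui; rewrite /rV_dot (bigD1 i) //= ltr_pwDl //.
  by rewrite -expr2 exprn_even_gt0.
by apply: sumr_ge0 => j _; rewrite -expr2 sqr_ge0.
Qed.

HB.instance Definition _ := isDotProduct.Build R _ (@rV_dot R d) rV_dot_gt0.

End RowDot.

(** The effects that complete [e] to the unit contribute nonnegative terms. For an infinite family,
    passing to the limit uses the continuity of [f]. *)
Lemma effect_le_unit (R : realType) (G : gpt R) (f : {scalar gpt_space G}) e :
  (forall x, effects G x -> 0 <= f x) -> effects G e -> f e <= f (gpt_unit G).
Proof.
move=> f0 /effect_complement [[s sE <-]|[x xE xu]].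
  by rewrite linearD linear_sum lerDl big_seq sumr_ge0 // => y /sE /f0.
have [w fw] := dot_riesz (gpt_ip G) f.
rewrite leNgt; apply/negP => fu.
have gap : 0 < f e - f (gpt_unit G) by rewrite subr_gt0.
set y := (fun n => _) in xu.
(* The fixed positive gap stays below a multiple of the distance from the partial sums to the unit,
   which tends to 0. *)
have fy n : f e - f (gpt_unit G) <=
    ip_norm (gpt_ip G) w * ip_norm (gpt_ip G) (y n - gpt_unit G).
  apply: le_trans (dot_cauchy_schwarz _ _ _); rewrite -fw.
  apply: le_trans (ler_norm _); rewrite linearB lerD2r /y linearD linear_sum.
  by rewrite lerDl sumr_ge0 // => i _; apply/f0/xE.
have cv : (fun n => ip_norm (gpt_ip G) w *
    ip_norm (gpt_ip G) (y n - gpt_unit G)) @ \oo --> (0 : R).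
  by rewrite -[0](mulr0 (ip_norm (gpt_ip G) w)); apply: cvgMr.
have [N _ /(_ N (leqnn N))] := cvgr0_norm_lt _ cv _ gap.
by move=> /= /(le_lt_trans (ler_norm _)); rewrite ltNge fy.
Qed.

(* A classical model with [d] hidden states: [a i] is the probability of the
   hidden state [i], and [b i] the response to an effect in that state. *)
Definition hidden_state_model (R : realType) (G : gpt R) (d : nat)
    (a b : 'I_d -> {scalar gpt_space G}) : Prop :=
  [/\ forall s i, states G s -> 0 <= a i s,
      forall s, states G s -> \sum_i a i s = 1,
      forall e i, effects G e -> 0 <= b i e <= 1
    & forall s e, gpt_ip G s e = \sum_i a i s * b i e].

(** * Passing between simplex embeddings and hidden-state models *)

Section HiddenStateModels.
Context {R : realType} {G : gpt R}.
Local Notation V := (gpt_space G).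

Lemma scalar_sum_scale d (a : 'I_d -> {scalar V}) (c : 'I_d -> R) :
  scalar (fun s => \sum_i a i s * c i).
Proof.
move=> r x y; rewrite mulr_sumr -big_split; apply: eq_bigr => i _ /=.
by rewrite linearP /= mulrDl mulrA.
Qed.

Lemma scalarB (f g : V -> R) : scalar f -> scalar g ->
  scalar (fun x => f x - g x).
Proof. by move=> hf hg a x y; rewrite hf hg; ring. Qed.

Lemma bilinear_form_eq d (a b : 'I_d -> {scalar V}) (A B : set V) :
  lin_span A = setT -> lin_span B = setT ->
  (forall s e, A s -> B e -> gpt_ip G s e = \sum_i a i s * b i e) ->
  forall s e, gpt_ip G s e = \sum_i a i s * b i e.
Proof.
move=> spanA spanB abE s e; apply/eqP; rewrite -subr_eq0; apply/eqP.
move: s; apply: (scalar_eq0_on_span _ spanA) => [|s As].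
  by apply: scalarB; [exact: dot_scalarl|exact: scalar_sum_scale].
move: e; apply: (scalar_eq0_on_span _ spanB) => [|e Be].
  apply: scalarB; first exact: dot_scalarr.
  under [X in scalar X]funext do under eq_bigr do rewrite mulrC.
  exact: scalar_sum_scale.
by rewrite abE // subrr.
Qed.

(** The [a i] are the barycentric coordinates of [iota s], and the [b i] pair [kappa e] with the
    vertices. *)
Lemma simplex_embeddable_model d :
  tomographically_complete G -> simplex_embeddable_in G d ->
  exists a b : 'I_d -> {scalar V}, hidden_state_model a b.
Proof.
move=> [spanS spanE] [W [ipW [delta [iota [kappa [dimW frd iotaP kappaP ipE]]]]]].
have hb i : scalar (fun e => ipW (kappa e) (tnth delta i)).
  by move=> r x y; rewrite linearP dot_scalarl.
have ha i : scalar (fun s => coord delta i (iota s)).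
  by move=> r x y; rewrite !linearP.
have deltaE c j : coord delta j (\sum_(i < d) c i *: tnth delta i) = c j.
  under eq_bigr do rewrite (tnth_nth 0).
  exact: coord_sum_free.
exists (fun i => scalar_of (ha i)), (fun i => scalar_of (hb i)); split.
- by move=> s i /iotaP [c [c0 _ sE]]; rewrite /= sE deltaE.
- move=> s /iotaP [c [_ c1 sE]]; rewrite -c1.
  by apply: eq_bigr => i _; rewrite /= sE deltaE.
- by move=> e i /kappaP; apply.
apply: (bilinear_form_eq spanS spanE) => s e Ss Ee.
rewrite ipE //; have [c [_ _ sE]] := iotaP _ Ss; rewrite sE linear_sumlz.
by apply: eq_bigr => i _; rewrite linearZl_LR /= sE deltaE (dotC _ (kappa e)).
Qed.

Lemma dim_rV d : \dim {: 'rV[R]_d} = d.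
Proof. by rewrite dimvf dim_matrix; apply: mul1n. Qed.

Definition row_of d (f : 'I_d -> {scalar V}) (v : V) : 'rV[R]_d :=
  \row_i f i v.

Fact row_of_linear d (f : 'I_d -> {scalar V}) : linear (row_of f).
Proof. by move=> r x y; apply/rowP => i; rewrite !mxE linearP. Qed.

HB.instance Definition _ d (f : 'I_d -> {scalar V}) :=
  GRing.isLinear.Build R V 'rV[R]_d *:%R (row_of f) (row_of_linear f).

(** The canonical basis serves as vertices: it is orthonormal, so pairing with a vertex reads off a
    coordinate. *)
Lemma model_simplex_embeddable d (a b : 'I_d -> {scalar V}) :
  hidden_state_model a b -> simplex_embeddable_in G d.
Proof.
move=> [a0 a1 b01 ipE].
pose delta := [tuple delta_mx 0 i : 'rV[R]_d | i < d].
exists 'rV[R]_d, (@rV_dot R d), delta, (row_of a), (row_of b).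
have deltaE (v : 'rV[R]_d) : v = \sum_i v 0 i *: tnth delta i.
  by rewrite {1}(row_sum_delta v); apply: eq_bigr => i _; rewrite tnth_mktuple.
split.
- exact: dim_rV.
- apply/freeP => k; under eq_bigr do rewrite -tnth_nth tnth_mktuple.
  move=> k0 i; have /rowP/(_ i) := k0; rewrite summxE mxE (bigD1 i) //= !mxE.
  rewrite !eqxx mulr1 big1 ?addr0 // => j ji.
  by rewrite !mxE eqxx eq_sym (negPf ji) mulr0.
- move=> s Ss; exists (fun i => row_of a s 0 i); split => //.
  + by move=> i; rewrite mxE a0.
  + by rewrite -(a1 s Ss); apply: eq_bigr => i _; rewrite mxE.
- move=> e Ee i; have := b01 e i Ee.
  suff -> : b i e = rV_dot (row_of b e) (tnth delta i) by [].
  rewrite tnth_mktuple /rV_dot (bigD1 i) //= !mxE !eqxx mulr1.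
  by rewrite big1 ?addr0 // => j ji; rewrite !mxE eqxx (negPf ji) mulr0.
- by move=> s e _ _; rewrite ipE; apply: eq_bigr => i _; rewrite !mxE.
Qed.

(** The map [row_of b] is injective: if all [b i e] vanish, then so does the product of [e] with
    itself. *)
Lemma model_dim_le d (a b : 'I_d -> {scalar V}) :
  hidden_state_model a b -> (\dim {: V} <= d)%N.
Proof.
move=> [_ _ _ ipE]; pose f := linfun (row_of b).
have f0 : (fullv :&: lker f = 0)%VS.
  apply/eqP; rewrite -subv0; apply/subvP => e; rewrite memv_cap memvf memv_ker.
  rewrite lfunE memv0 => /eqP/rowP be; apply/eqP/(dot_eq0 (ip := gpt_ip G)).
  by rewrite ipE big1 // => i _; have := be i; rewrite !mxE => ->; rewrite mulr0.
rewrite -(limg_dim_eq f0) (leq_trans (dimvS (subvf _))) //.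
by rewrite dim_rV.
Qed.

(** * Reducing the number of hidden states *)

Lemma lin_span_vbasis (U : vectType R) :
  lin_span [set (vbasis {: U})`_i | i in [set: 'I_(\dim {: U})]] = setT.
Proof.
rewrite -subTset => v _.
exists (\dim {: U}), (fun i => (vbasis {: U})`_i),
  (fun i => coord (vbasis {: U}) i v); split; first by move=> i; exists i.
exact/coord_vbasis/memvf.
Qed.

Lemma weights_caratheodory d (a b : 'I_d -> {scalar V}) :
  hidden_state_model a b ->
  exists (m : nat) (h : 'I_m -> 'I_d) (c : 'I_m -> R),
    [/\ (m <= \dim {: V} ^ 2)%N, forall j, 0 <= c j
      & forall s e, gpt_ip G s e = \sum_j c j * a (h j) s * b (h j) e].
Proof.
move=> [_ _ _ ipE]; pose n : nat := \dim {: V}; pose B := vbasis {: V}.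
(* [x i] is the matrix of the rank-one form [a i * b i] in the basis [B]; the bound is the dimension
   of the matrix space. The initial weights are all 1. *)
pose x i : 'M[R]_n := \matrix_(p, q) (a i B`_p * b i B`_q).
have [//|c [c0 cx csupp]] := @conic_caratheodory _ _ _ x (fun=> 1).
pose S := [pred i | c i != 0]; pose h (j : 'I_#|S|) := enum_val j.
exists #|S|, h, (fun j => c (h j)); split => //.
  by rewrite (leq_trans csupp) // dimvf dim_matrix -mulnn; apply: leqnn.
have ha i : scalar (fun s => c (h i) * a (h i) s).
  by move=> r u v; rewrite linearP /=; ring.
apply: (bilinear_form_eq (a := fun i => scalar_of (ha i)) (b := b \o h)
  (lin_span_vbasis V) (lin_span_vbasis V)) => _ _ [p _ <-] [q _ <-].
have /matrixP/(_ p q) := cx; rewrite !summxE ipE.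
under eq_bigr do rewrite !mxE; under [RHS]eq_bigr do rewrite !mxE mul1r.
move=> <-; rewrite (bigID (mem S)) /= [X in _ + X]big1 ?addr0 => [|i]; last first.
  by rewrite inE negbK => /eqP ->; rewrite mul0r.
by rewrite big_enum_val; apply: eq_bigr => j _; rewrite mulrA.
Qed.

Lemma model_reduce d (a b : 'I_d -> {scalar V}) :
  tomographically_complete G -> hidden_state_model a b ->
  exists (m : nat) (a' b' : 'I_m -> {scalar V}),
    (m <= \dim {: V} ^ 2)%N /\ hidden_state_model a' b'.
Proof.
move=> [_ spanE] M; have [a0 _ b01 _] := M.
have [m [h [c [mV c0 ipE]]]] := weights_caratheodory M.
pose u := gpt_unit G.
have b0 i e : effects G e -> 0 <= b i e.
  by move=> Ee; have /andP[] := b01 e i Ee.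
have bu i e : effects G e -> b i e <= b i u.
  exact: effect_le_unit (b0 i).
(* On effects, [b i] is squeezed between 0 and [b i u]; the effects span the space. *)
have bu0 i e : b i u = 0 -> b i e = 0.
  move=> biu; move: e.
  apply: (scalar_eq0_on_span _ spanE) => [|x Ex]; first exact: linearP.
  by apply/le_anti; rewrite b0 // -biu bu.
have ha j : scalar (fun s => c j * b (h j) u * a (h j) s).
  by move=> r x y; rewrite linearP /=; ring.
have hb j : scalar (fun e => b (h j) e / b (h j) u).
  by move=> r x y; rewrite linearP /=; ring.
exists m, (fun j => scalar_of (ha j)), (fun j => scalar_of (hb j)).
split => //; split => /= [s j Ss|s Ss|e j Ee|s e].
- by rewrite !mulr_ge0 ?a0 ?b0 //; apply: unit_effect.
(* The new weights sum to the decomposition of the product of [s] with the unit. *)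
- rewrite -(unit_normalized Ss) ipE; apply: eq_bigr => j _.
  by rewrite mulrAC.
- have := b0 (h j) _ (unit_effect G); rewrite -/u le_eqVlt => /orP[/eqP/esym bz|bp].
    by rewrite bz invr0 mulr0 lexx ler01.
  by rewrite divr_ge0 ?(ltW bp) ?b0 // ler_pdivrMr // mul1r bu.
rewrite ipE; apply: eq_bigr => j _.
(* when [b (h j) u = 0], both sides vanish: the junk value [x / 0] is harmless *)
have [bz|bp] := eqVneq (b (h j) u) 0; last by field.
by rewrite (bu0 _ e bz) mul0r !mulr0.
Qed.

End HiddenStateModels.

Theorem corollary37 (R : realType) (G : gpt R)
    (tomo : tomographically_complete G)
    (emb : exists d : nat, simplex_embeddable_in G d) :
  exists dmin : nat,
    (\dim {: gpt_space G} <= dmin <= \dim {: gpt_space G} ^ 2)%N /\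
    simplex_embeddable_in G dmin.
Proof.
have [d /(simplex_embeddable_model tomo) [a [b M]]] := emb.
have [m [a' [b' [mV M']]]] := model_reduce tomo M.
exists m; split; last exact: model_simplex_embeddable M'.
by rewrite (model_dim_le M') mV.
Qed.
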